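(* Consider the discrete-time linear system $x_{k+1} = Ax_k + Bu_k + w_k$, $k\in\mathbb{N}$, with $x_k\in\mathbb{R}^n$, $u_k\in\mathbb{R}^m$, $x_0 = 0$, $(A,B)$ controllable, and i.i.d. process noise $w_k\sim N(0,W)$ with $W\succ 0$. Let $Q\succ 0$, $R\succ 0$. Let $K_0, K_1\in\mathbb{R}^{m\times n}$ be arbitrary gains with $\rho(A+BK_0)<1$ (no assumption on $K_1$), and let $M>0$, $t\in\mathbb{N}^*$. Let the input be generated by the following switched controller: a counter $\xi_k$ starts at $\xi_0=0$; at step $k$, if $\xi_k>0$ then $u_k = K_0x_k$ and $\xi_{k+1}=\xi_k-1$; if $\xi_k=0$ and $\|x_k\|\ge M$ then $u_k=K_0x_k$ and $\xi_{k+1}=t-1$; if $\xi_k=0$ and $\|x_k\|<M$ then $u_k=K_1x_k$ and $\xi_{k+1}=0$. Let $P_0\succ 0$ and $0<\rho_0<1$ satisfy $(A+BK_0)^TP_0(A+BK_0)\prec \rho_0 P_0$. Then the cost $$J=\limsup_{T\to\infty}\frac1T\mathbb{E}\Big[\sum_{k=0}^{T-1} x_k^TQx_k + u_k^TRu_k\Big]$$ satisfies $$J < \frac{\big(M^2\mathcal{A}^2\|P_0\| + \operatorname{tr}(WP_0)\big)\,\|Q_{01}\|_{P_0}}{1-\rho_0},$$ where $\mathcal{A} = \max\{\|A+BK_0\|,\|A+BK_1\|\}$ and $Q_{01} = Q + K_0^TRK_0 + K_1^TRK_1$.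
   Context: $\rho(\cdot)$ is the spectral radius, $\|\cdot\|$ is the Euclidean norm for vectors and the induced 2-norm for matrices. For positive definite matrices $P, Q'$, $\|Q'\|_P = \|P^{-1/2}Q'P^{-1/2}\| = \sup_{\|P^{1/2}v\|=1} v^TQ'v$. *)

(* Defs.v *)
From HB Require Import structures.
From mathcomp Require Import all_boot all_order all_algebra.
From mathcomp Require Import all_classical all_reals all_analysis.
From mathcomp Require Import complex.


Set Implicit Arguments.
Unset Strict Implicit.
Unset Printing Implicit Defensive.

Import Order.TTheory GRing.Theory Num.Theory.
Import numFieldNormedType.Exports.

Local Open Scope classical_set_scope.
Local Open Scope ring_scope.

Section Defs.
Variable R : realType.

Definition vnorm (n : nat) (x : 'cV[R]_n) : R := Num.sqrt (\sum_i x i 0 ^+ 2).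

Definition qform (n : nat) (M : 'M[R]_n) (v : 'cV[R]_n) : R := (v^T *m M *m v) 0 0.

Definition mnorm (p q : nat) (M : 'M[R]_(p, q)) : R :=
  sup [set vnorm (M *m v) | v in [set v : 'cV[R]_q | vnorm v = 1]].

(* ||Q'||_P = sup_{ ||P^{1/2} v|| = 1 } v^T Q' v  (i.e. v^T P v = 1) *)
Definition pnorm (n : nat) (P Q' : 'M[R]_n) : R :=
  sup [set qform Q' v | v in [set v : 'cV[R]_n | qform P v = 1]].

Definition posdef (n : nat) (M : 'M[R]_n) : Prop :=
  M^T = M /\ forall v : 'cV[R]_n, v != 0 -> 0 < qform M v.

Definition spectral_radius (n : nat) (M : 'M[R]_n) : R :=
  sup [set Normc.normc z | z in
        [set z : R[i] | eigenvalue (map_mx (fun x : R => x%:C%C) M) z]].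

(* (A,B) controllable: the controllability matrix [B AB ... A^(n-1)B] has
   full row rank, i.e. its range is all of R^n *)
Definition controllable (n m : nat) (A : 'M[R]_n) (B : 'M[R]_(n, m)) : Prop :=
  forall x : 'cV[R]_n, exists us : 'I_n -> 'cV[R]_m,
    x = \sum_(k < n) A ^+ k *m B *m us k.

Definition switched_ctrl (n m : nat) (K0 K1 : 'M[R]_(m, n)) (Mth : R) (t : nat)
    (x : 'cV[R]_n) (xi : nat) : 'cV[R]_m * nat :=
  if (0 < xi)%N then (K0 *m x, xi.-1)
  else if Mth <= vnorm x then (K0 *m x, t.-1)
  else (K1 *m x, 0%N).

Fixpoint cl_state (n m : nat) (A : 'M[R]_n) (B : 'M[R]_(n, m))
    (K0 K1 : 'M[R]_(m, n)) (Mth : R) (t : nat) (w : nat -> 'cV[R]_n) (k : nat)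
    : 'cV[R]_n * nat :=
  match k with
  | 0 => (0, 0%N)
  | k'.+1 =>
      let s := cl_state A B K0 K1 Mth t w k' in
      let c := switched_ctrl K0 K1 Mth t s.1 s.2 in
      (A *m s.1 + B *m c.1 + w k', c.2)
  end.

Definition cl_x n m A B K0 K1 Mth t w k : 'cV[R]_n :=
  (@cl_state n m A B K0 K1 Mth t w k).1.

Definition cl_u n m A B K0 K1 Mth t w k : 'cV[R]_m :=
  let s := @cl_state n m A B K0 K1 Mth t w k in
  (switched_ctrl K0 K1 Mth t s.1 s.2).1.

End Defs.

Section Prob.
Context {R : realType} {d : measure_display} {Omega : measurableType d}.

Definition sigma_rv (n : nat) (X : Omega -> 'cV[R]_n) : set (set Omega) :=
  <<s [set E | exists i : 'I_n, exists2 A : set R,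
                 measurable A & E = (fun o => X o i 0) @^-1` A] >>.

Definition mutually_independent (P : probability Omega R) (n : nat)
    (X : nat -> Omega -> 'cV[R]_n) : Prop :=
  forall (ks : seq nat) (E : nat -> set Omega), uniq ks ->
    (forall k, k \in ks -> sigma_rv (X k) (E k)) ->
    P (\bigcap_(k in [set k | k \in ks]) E k) = (\prod_(k <- ks) P (E k))%E.

(* X ~ N(0, W) (W positive definite): X is a random vector and every nonzero
   linear combination v^T X is real normal with mean 0 and variance v^T W v *)
Definition gaussian_vec (P : probability Omega R) (n : nat) (W : 'M[R]_n)
    (X : Omega -> 'cV[R]_n) : Prop :=
  (forall i : 'I_n, measurable_fun setT (fun o => X o i 0)) /\
  forall v : 'cV[R]_n, v != 0 -> forall A : set R, measurable A ->
    P ((fun o => (v^T *m X o) 0 0) @^-1` A) =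
    normal_prob 0 (Num.sqrt (qform W v)) A.

End Prob.

(* Main.v *)
(**
  Let V k be the expectation of x_k^T P0 x_k.  The noise w_k is centred and
  independent of the state x_k, so
  V (k+1) = E[y_k^T P0 y_k] + tr (W P0), where y_k is the noise-free successor.
  If K0 is active, y_k^T P0 y_k <= r x_k^T P0 x_k, where r < rho0 exists
  because the Lyapunov inequality is strict; if K1 is active, |x_k| < M, hence
  y_k^T P0 y_k <= M^2 calA^2 ||P0||.  Adding the two bounds,
  V (k+1) <= r V k + C with C = M^2 calA^2 ||P0|| + tr (W P0) > 0, and therefore
  V k <= C / (1 - r) < C / (1 - rho0).  Each stage cost is at most
  ||Q01||_P0 x_k^T P0 x_k.
*)

Require Import Defs.
From HB Require Import structures.
From mathcomp Require Import all_boot all_order all_algebra.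
From mathcomp Require Import all_classical all_reals all_analysis.
From mathcomp Require Import complex measurable_realfun ring lra.
Import Order.TTheory GRing.Theory Num.Theory.
Import numFieldNormedType.Exports.
Local Open Scope classical_set_scope.
Local Open Scope ring_scope.

Set Implicit Arguments.
Unset Strict Implicit.
Unset Printing Implicit Defensive.

(** The delicate point is that the cross terms between [y_k] and [w_k] have mean zero: independence
    is given between noise events only, while [y_k] depends on all earlier noise through a
    discontinuous switching rule. So [y_k] is shown measurable for the sigma-algebra of
    [w_0, ..., w_(k-1)], and a pi-lambda argument makes that sigma-algebra independent of [w_k].
    Gaussianity is likewise given only through the laws of the scalars [v^T w_k]; means and
    covariances are recovered from these, starting from the variance of the one-dimensional normal
    law. A limsup preserves only non-strict bounds, so strictness is secured beforehand, by a rate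
    [r < rho0] independent of time and by the positivity of [C] and of [||Q01||_P0]. With [x_0 = 0]
    the bound on [V k] holds at every step, not only asymptotically, so the time averages are
    bounded term by term. *)

Section LinearAlgebra.
Variable R : realType.

(** * Linear algebra: quadratic forms, and the suprema [mnorm] and [pnorm] as upper bounds *)

Definition bform (n : nat) (M : 'M[R]_n) (u v : 'cV[R]_n) : R :=
  (u^T *m M *m v) 0 0.

Definition sqnorm (n : nat) (v : 'cV[R]_n) : R := \sum_i v i 0 ^+ 2.

Lemma bformE n (M : 'M[R]_n) u v :
  bform M u v = \sum_i \sum_j M i j * (u i 0 * v j 0).
Proof.
rewrite /bform -mulmxA mxE; apply: eq_bigr => i _.
rewrite !mxE mulr_sumr; apply: eq_bigr => j _; ring.
Qed.

Lemma bformC n (M : 'M[R]_n) u v : M^T = M -> bform M u v = bform M v u.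
Proof.
move=> symM; by rewrite /bform -[in LHS](trmxK (u^T *m M *m v)) mxE !trmx_mul trmxK symM mulmxA.
Qed.

Lemma qform_comb n (M : 'M[R]_n) (a b : R) u v : M^T = M ->
  qform M (a *: u + b *: v) =
  a ^+ 2 * qform M u + 2 * a * b * bform M u v + b ^+ 2 * qform M v.
Proof.
move=> symM.
have -> : 2 * a * b * bform M u v =
    a * b * bform M u v + a * b * bform M v u.
  by rewrite (bformC v u)//; ring.
rewrite /qform /bform !linearD/= !linearZ/= !(mulmxDl, mulmxDr).
by rewrite -!(scalemxAl, scalemxAr) !mxE; ring.
Qed.

Lemma qformZ n (M : 'M[R]_n) (a : R) v : qform M (a *: v) = a ^+ 2 * qform M v.
Proof. by rewrite /qform !linearZ/= -!scalemxAl !mxE; ring. Qed.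

Lemma qformD_mx n (M N : 'M[R]_n) v : qform (M + N) v = qform M v + qform N v.
Proof. by rewrite /qform mulmxDr mulmxDl mxE. Qed.

Lemma qformB_mx n (M N : 'M[R]_n) v : qform (M - N) v = qform M v - qform N v.
Proof. by rewrite /qform mulmxBr mulmxBl !mxE. Qed.

Lemma qformZ_mx n (a : R) (M : 'M[R]_n) v : qform (a *: M) v = a * qform M v.
Proof. by rewrite /qform -scalemxAr -scalemxAl mxE. Qed.

Lemma qform_congr n m (M : 'M[R]_m) (K : 'M[R]_(m, n)) v :
  qform (K^T *m M *m K) v = qform M (K *m v).
Proof. by rewrite /qform trmx_mul !mulmxA. Qed.

Lemma qform0 n (M : 'M[R]_n) : qform M 0 = 0.
Proof. by rewrite /qform mulmx0 mxE. Qed.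

Lemma posdef_ge0 n (M : 'M[R]_n) v : posdef M -> 0 <= qform M v.
Proof.
move=> [_ pM]; have [->|v0] := eqVneq v 0; first by rewrite qform0.
exact/ltW/pM.
Qed.

Lemma posdef_CauchySchwarz n (M : 'M[R]_n) u v : posdef M ->
  bform M u v ^+ 2 <= qform M u * qform M v.
Proof.
move=> pM; have [symM pos] := pM.
have [->|v0] := eqVneq v 0.
  by rewrite qform0 mulr0 /bform mulmx0 mxE expr0n.
have qv := pos _ v0.
(* Up to the factor [qform M v], this vector is the component of [u] that is [M]-orthogonal to
   [v]. *)
have := posdef_ge0 (qform M v *: u + (- bform M u v) *: v) pM.
rewrite qform_comb// => h.
have {h} : 0 <= qform M v * (qform M u * qform M v - bform M u v ^+ 2).
  by apply: le_trans h _; rewrite le_eqVlt; apply/orP; left; apply/eqP; ring.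
by rewrite pmulr_rge0// subr_ge0.
Qed.

Lemma sqnorm_ge0 n (v : 'cV[R]_n) : 0 <= sqnorm v.
Proof. by apply: sumr_ge0 => i _; exact: sqr_ge0. Qed.

Lemma sqnorm_gt0 n (v : 'cV[R]_n) : v != 0 -> 0 < sqnorm v.
Proof.
move=> v0; rewrite lt_neqAle sqnorm_ge0 andbT eq_sym.
apply: contra v0 => /eqP s0; apply/eqP/matrixP => i j; rewrite mxE (ord1 j).
have /(psumr_eq0P _) : sqnorm v = 0 by [].
by move=> /(_ (fun i _ => sqr_ge0 (v i 0)) i erefl)/eqP; rewrite sqrf_eq0 => /eqP.
Qed.

Lemma qform1 n (v : 'cV[R]_n) : qform 1%:M v = sqnorm v.
Proof.
rewrite /qform mulmx1 mxE; apply: eq_bigr => i _.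
by rewrite mxE expr2.
Qed.

Lemma posdef1 n : posdef (1%:M : 'M[R]_n).
Proof.
by split; [exact: trmx1|move=> v v0; rewrite qform1 sqnorm_gt0].
Qed.

Lemma CauchySchwarz n (u v : 'cV[R]_n) :
  (u^T *m v) 0 0 ^+ 2 <= sqnorm u * sqnorm v.
Proof.
by have := posdef_CauchySchwarz u v (posdef1 n); rewrite /bform mulmx1 !qform1.
Qed.

Lemma posdef_unitmx n (M : 'M[R]_n) : posdef M -> M \in unitmx.
Proof.
move=> [symM pM]; rewrite -row_free_unit -kermx_eq0; apply/negPn/negP.
move=> /rowV0Pn[v /sub_kermxP vM v0].
have /pM : v^T != 0 by rewrite trmx_eq0.
by rewrite /qform trmxK vM mul0mx mxE ltxx.
Qed.

(* Cauchy-Schwarz for the form [M] applied to [invmx M *m e_i] and [v] bounds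
   each coordinate of [v]. *)
Lemma posdef_lower n (M : 'M[R]_n) : posdef M ->
  exists2 c : R, 0 < c & forall v, c * sqnorm v <= qform M v.
Proof.
move=> pM; have uM := posdef_unitmx pM.
pose z i : 'cV[R]_n := invmx M *m delta_mx i 0.
have coord i v : bform M (z i) v = v i 0.
  rewrite bformC ?pM.1// /bform /z mulmxA mulmxK// mxE (bigD1 i)//= big1.
    by rewrite !mxE !eqxx mulr1 addr0.
  by move=> j ji; rewrite !mxE (negbTE ji) mulr0.
pose S : R := \sum_i qform M (z i).
have S0 : 0 <= S by apply: sumr_ge0 => i _; exact: posdef_ge0.
(* The [+ 1] makes the denominator positive also for [n = 0], where [S] is an empty sum. *)
exists (S + 1)^-1; first by rewrite invr_gt0 ltr_wpDl.
move=> v; rewrite ler_pdivrMl ?ltr_wpDl//.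
apply: (@le_trans _ _ (S * qform M v)); last first.
  by rewrite ler_wpM2r ?posdef_ge0// lerDl.
rewrite /S mulr_suml; apply: ler_sum => i _.
by rewrite -coord; exact: posdef_CauchySchwarz.
Qed.

Lemma vnormE n (v : 'cV[R]_n) : vnorm v = Num.sqrt (sqnorm v).
Proof. by []. Qed.

Lemma vnorm_sqr n (v : 'cV[R]_n) : vnorm v ^+ 2 = sqnorm v.
Proof. by rewrite vnormE sqr_sqrtr// sqnorm_ge0. Qed.

Lemma vnorm_ge0 n (v : 'cV[R]_n) : 0 <= vnorm v.
Proof. exact: sqrtr_ge0. Qed.

Lemma sqnormZ n (a : R) (v : 'cV[R]_n) : sqnorm (a *: v) = a ^+ 2 * sqnorm v.
Proof. by rewrite -!qform1 qformZ. Qed.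

Lemma vnormZ n (a : R) (v : 'cV[R]_n) : 0 <= a -> vnorm (a *: v) = a * vnorm v.
Proof.
by move=> a0; rewrite !vnormE sqnormZ sqrtrM ?sqr_ge0// sqrtr_sqr ger0_norm.
Qed.

Lemma vnorm_gt0 n (v : 'cV[R]_n) : v != 0 -> 0 < vnorm v.
Proof. by move=> /sqnorm_gt0; rewrite vnormE sqrtr_gt0. Qed.

Lemma sqnorm_mulmx p q (M : 'M[R]_(p, q)) v :
  sqnorm (M *m v) <= (\sum_i sqnorm (row i M)^T) * sqnorm v.
Proof.
rewrite {1}/sqnorm mulr_suml; apply: ler_sum => i _.
apply: le_trans (CauchySchwarz _ _); rewrite trmxK.
by rewrite -row_mul [X in _ <= X ^+ 2]mxE.
Qed.

Lemma vnorm_mulmx p q (M : 'M[R]_(p, q)) v : vnorm (M *m v) <= mnorm M * vnorm v.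
Proof.
have [->|v0] := eqVneq v 0.
  by rewrite mulmx0 !vnormE -!qform1 !qform0 sqrtr0 mulr0.
have nv := vnorm_gt0 v0.
rewrite -ler_pdivrMr// mulrC -vnormZ ?invr_ge0 ?vnorm_ge0// scalemxAr.
apply: ub_le_sup; last first.
  exists ((vnorm v)^-1 *: v) => //=.
  by rewrite vnormZ ?invr_ge0 ?vnorm_ge0// mulVf// gt_eqF.
(* The Frobenius norm bounds the set; the [sup] of an unbounded set would be a default value, not an
   upper bound. *)
exists (Num.sqrt (\sum_i sqnorm (row i M)^T)) => _ [u /= u1 <-].
rewrite vnormE ler_sqrt//; last by apply: sumr_ge0 => i _; exact: sqnorm_ge0.
by apply: le_trans (sqnorm_mulmx _ _) _; rewrite -vnorm_sqr u1 expr1n mulr1.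
Qed.

Lemma mnorm_ge0 n (M : 'M[R]_n) : (0 < n)%N -> 0 <= mnorm M.
Proof.
case: n M => // n M _.
have v0 : const_mx 1 != 0 :> 'cV[R]_n.+1.
  by apply/eqP => /matrixP/(_ 0 0)/eqP; rewrite !mxE oner_eq0.
have := vnorm_mulmx M (const_mx 1).
by move=> /(le_trans (vnorm_ge0 _)); rewrite pmulr_lge0// vnorm_gt0.
Qed.

Lemma qform_le_mnorm n (M : 'M[R]_n) v : qform M v <= mnorm M * sqnorm v.
Proof.
have cs := CauchySchwarz v (M *m v).
have -> : qform M v = (v^T *m (M *m v)) 0 0 by rewrite /qform mulmxA.
apply: (@le_trans _ _ (vnorm v * vnorm (M *m v))).
  rewrite (le_trans (ler_norm _))// -sqrtr_sqr !vnormE -sqrtrM ?sqnorm_ge0//.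
  by rewrite ler_wsqrtr.
by rewrite -vnorm_sqr expr2 mulrCA ler_wpM2l ?vnorm_ge0// vnorm_mulmx.
Qed.

Lemma qform_le_pnorm n (P Q : 'M[R]_n) v : posdef P ->
  qform Q v <= pnorm P Q * qform P v.
Proof.
move=> pP; have [->|v0] := eqVneq v 0; first by rewrite !qform0 mulr0.
have qv := pP.2 _ v0.
have [c c0 cP] := posdef_lower pP.
rewrite -ler_pdivrMr//.
have -> : qform Q v / qform P v = qform Q ((Num.sqrt (qform P v))^-1 *: v).
  by rewrite qformZ exprVn sqr_sqrtr ?ltW// mulrC.
apply: ub_le_sup; last first.
  exists ((Num.sqrt (qform P v))^-1 *: v) => //=.
  by rewrite qformZ exprVn sqr_sqrtr ?ltW// mulVf// gt_eqF.
(* By [cP], the ellipsoid [qform P u = 1] lies in the ball [sqnorm u <= 1 / c], which bounds the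
   set. *)
exists (`|mnorm Q| / c) => _ [u /= u1 <-].
apply: le_trans (qform_le_mnorm _ _) _.
apply: (@le_trans _ _ (`|mnorm Q| * sqnorm u)).
  by rewrite ler_wpM2r ?sqnorm_ge0// ler_norm.
by rewrite ler_wpM2l// -[leRHS]mul1r ler_pdivlMr// mulrC -u1.
Qed.

End LinearAlgebra.

(** * Variance of the centred normal law *)

Section NormalMoments.
Variable R : realType.
Let mu := @lebesgue_measure R.

(** The Radon-Nikodym derivative of [normal_prob] and [normal_pdf] have the same integral over every
    measurable set, hence agree almost everywhere. *)
Lemma ge0_integral_normal_prob (m s : R) (f : R -> \bar R) :
  measurable_fun setT f -> (forall x, 0 <= f x)%E ->
  (\int[normal_prob m s]_x f x = \int[mu]_x (f x * (normal_pdf m s x)%:E))%E.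
Proof.
move=> mf f0; have dom := normal_prob_dominates m s.
rewrite -(Radon_Nikodym_SigmaFinite.change_of_variables dom)//.
have mpdf : measurable_fun setT (EFin \o normal_pdf m s).
  apply/measurable_EFinP. exact: measurable_normal_pdf.
have iRN := Radon_Nikodym_SigmaFinite.f_integrable dom.
apply: ae_eq_integral => //.
- by apply: emeasurable_funM => //; exact: measurable_int iRN.
- exact: emeasurable_funM.
- apply: ae_eqe_mul2l; apply: integral_ae_eq => // E _ mE.
  by rewrite -Radon_Nikodym_SigmaFinite.f_integral.
Qed.

Section variance.
Variables (s : R) (s0 : 0 < s).
Let p := normal_pdf 0 s.
(** Comes from integration by parts: [p' = - (x / s^2) p], so differentiating [- s^2 x p] gives
    [(x^2 - s^2) p]. *)
Let F x : R := - (s ^+ 2 * (x * p x)).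

Let pE x : p x = normal_peak s * expR (- (s ^+ 2 *+ 2)^-1 * x ^+ 2).
Proof.
rewrite /p normal_pdfE ?gt_eqF// /normal_fun subr0 !mulNr.
by rewrite [_^-1 * x ^+ 2]mulrC.
Qed.

Let is_derive_F (x : R) : is_derive x (1 : R) F ((x ^+ 2 - s ^+ 2) * p x).
Proof.
have -> : F = fun x => - s ^+ 2 * normal_peak s *
    (x * expR (- (s ^+ 2 *+ 2)^-1 * x ^+ 2)).
  by apply/funext => y; rewrite /F pE; ring.
apply: is_derive_eq.
have s2 : s != 0 by rewrite gt_eqF.
by rewrite pE /GRing.scale/=; field.
Qed.

Let p_ge0 x : 0 <= p x. Proof. exact: normal_pdf_ge0. Qed.

(** With [y = x^2 / (2 s^2)], the bound [exp (- y) <= 1 / y] is enough to beat the factor [x]: it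
    leaves a constant over [x]. *)
Let F_cvg : F x @[x --> +oo] --> 0.
Proof.
apply/cvgrPdist_le => e e0.
have k0 := normal_peak_ge0 s.
near=> x.
have x0 : 0 < x by near: x; exact: nbhs_pinfty_gt.
rewrite sub0r normrN /F normrN ger0_norm; last first.
  by rewrite mulr_ge0 ?sqr_ge0// mulr_ge0 ?p_ge0// ltW.
have y0 : 0 < x ^+ 2 / (s ^+ 2 *+ 2).
  by rewrite divr_gt0 ?exprn_gt0// pmulrn_lgt0// exprn_gt0.
have he : expR (- (s ^+ 2 *+ 2)^-1 * x ^+ 2) <= (x ^+ 2 / (s ^+ 2 *+ 2))^-1.
  rewrite mulNr mulrC expRN lef_pV2 ?posrE ?expR_gt0//.
  by apply: le_trans (expR_ge1Dx _); rewrite lerDr.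
rewrite pE.
apply: (@le_trans _ _ (s ^+ 2 * (x * (normal_peak s * (x ^+ 2 / (s ^+ 2 *+ 2))^-1)))).
  by rewrite !ler_wpM2l ?sqr_ge0// ltW.
have -> : s ^+ 2 * (x * (normal_peak s * (x ^+ 2 / (s ^+ 2 *+ 2))^-1)) =
    (2 * s ^+ 4 * normal_peak s) / x.
  by field; rewrite !gt_eqF.
rewrite ler_pdivrMr// [leRHS]mulrC -ler_pdivrMr//.
Unshelve. all: by end_near. Qed.

Let cp : continuous p. Proof. by apply: continuous_normal_pdf; rewrite gt_eqF. Qed.

Let mp : measurable_fun setT p. Proof. exact: measurable_normal_pdf. Qed.

Let m2p : measurable_fun setT (fun x : R => x ^+ 2 * p x).
Proof. by apply: measurable_funM => //; exact: exprn_measurable. Qed.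

Let cf : continuous (fun x : R => (x ^+ 2 - s ^+ 2) * p x).
Proof.
move=> x; apply: cvgM; last exact: cp.
by apply: (@cvgB _ R^o); [exact: exprn_continuous|exact: cvg_cst].
Qed.

Let cF : continuous F.
Proof.
move=> x; apply: differentiable_continuous; apply/derivable1_diffP.
by have [] := is_derive_F x.
Qed.

Let F'E x : F^`()%classic x = (x ^+ 2 - s ^+ 2) * p x.
Proof. by rewrite derive1E; have [_ ->] := is_derive_F x. Qed.

Let integral_tail :
  (\int[mu]_(x in `[s, +oo[) ((x ^+ 2 - s ^+ 2) * p x)%:E = (- F s)%:E)%E.
Proof.
rewrite (@ge0_continuous_FTC2y _ (fun x => (x ^+ 2 - s ^+ 2) * p x) F s 0).
- by rewrite sub0e -EFinN.
- move=> x sx; rewrite mulr_ge0// subr_ge0 ler_sqr ?nnegrE ?(ltW s0)//.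
  exact: le_trans (ltW s0) sx.
- exact: continuous_subspaceT.
- exact: F_cvg.
- by move=> x _; have [] := is_derive_F x.
- exact/cvg_at_right_filter/cF.
- by move=> x _; exact: F'E.
Qed.

(** [F] vanishes at 0 as well as at infinity, so the deficit of [x^2] against [s^2] below [s] and
    its excess above [s] have the same weight [- F s]; they cancel in [half_second_moment]. *)
Let integral_head :
  (\int[mu]_(x in `[0%R, s]) ((s ^+ 2 - x ^+ 2) * p x)%:E = (- F s)%:E)%E.
Proof.
have dG (x : R) : is_derive x (1 : R) (\- F) ((s ^+ 2 - x ^+ 2) * p x).
  rewrite -(opprB (x ^+ 2)) mulNr.
  exact: (is_deriveN (is_derive_F x)).
have cg : continuous (fun x : R => (s ^+ 2 - x ^+ 2) * p x).
  move=> x; apply: cvgM; last exact: cp.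
  by apply: (@cvgB _ R^o); [exact: cvg_cst|exact: exprn_continuous].
have cG : continuous (\- F) by move=> x; apply: (@cvgN _ R^o); exact: cF.
rewrite (@continuous_FTC2 _ (fun x => (s ^+ 2 - x ^+ 2) * p x) (\- F))//.
- by rewrite /= {2}/F mul0r mulr0 oppr0 oppr0 sube0.
- exact: continuous_subspaceT.
- split.
  + by move=> x _; have [] := dG x.
  + exact/cvg_at_right_filter/cG.
  + exact/cvg_at_left_filter/cG.
- by move=> x _; rewrite derive1E; have [_ ->] := dG x.
Qed.

Let split_half (f : R -> R) : measurable_fun setT f -> (forall x, 0 <= f x) ->
  (\int[mu]_(x in `[0%R, +oo[) (f x)%:E =
   \int[mu]_(x in `[0%R, s]) (f x)%:E + \int[mu]_(x in `[s, +oo[) (f x)%:E)%E.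
Proof.
move=> mf f0.
have -> : `[0, +oo[%classic = `[0, s] `|` `]s, +oo[ :> set R.
  by rewrite -itv_bndbnd_setU ?bnd_simp// ltW.
rewrite ge0_integral_setU//=.
- by rewrite integral_itv_obnd_cbnd//; exact/measurable_EFinP/measurable_funTS.
- exact/measurable_EFinP/measurable_funTS.
- by move=> x _; rewrite lee_fin.
- apply/disj_setPS => x [] /=; rewrite !in_itv/= andbT => /andP[_ xs] sx.
  by move: (lt_le_trans sx xs); rewrite ltxx.
Qed.

(* [F] is an antiderivative of [(x^2 - s^2) p x], whose sign changes at [s];
   cutting there keeps all the integrands nonnegative. *)
Let half_second_moment :
  (\int[mu]_(x in `[0%R, +oo[) (x ^+ 2 * p x)%:E =
   (s ^+ 2)%:E * \int[mu]_(x in `[0%R, +oo[) (p x)%:E)%E.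
Proof.
have x2p0 x : 0 <= x ^+ 2 * p x by rewrite mulr_ge0// sqr_ge0.
have s2p0 x : 0 <= s ^+ 2 * p x by rewrite mulr_ge0// sqr_ge0.
have ms2p : measurable_fun setT (fun x : R => s ^+ 2 * p x).
  exact: measurable_funM.
rewrite -ge0_integralZl//=; last 3 first.
- exact/measurable_EFinP/measurable_funTS.
- by move=> x _; rewrite lee_fin.
- by rewrite lee_fin sqr_ge0.
under [RHS]eq_integral do rewrite -EFinM.
rewrite !split_half//.
have headE : (\int[mu]_(x in `[0%R, s]) (x ^+ 2 * p x)%:E + (- F s)%:E =
    \int[mu]_(x in `[0%R, s]) (s ^+ 2 * p x)%:E)%E.
  rewrite -integral_head -ge0_integralD//=.
  - by apply: eq_integral => x _; rewrite -EFinD -mulrDl addrC subrK.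
  - by move=> x _; rewrite lee_fin.
  - exact/measurable_EFinP/measurable_funTS.
  - move=> x; rewrite in_itv/= => /andP[x0 xs].
    by rewrite lee_fin mulr_ge0// subr_ge0 ler_sqr ?nnegrE ?(ltW s0).
  - apply/measurable_EFinP/measurable_funTS; apply: measurable_funM => //.
    by apply: measurable_funB => //; exact: exprn_measurable.
have tailE : (\int[mu]_(x in `[s, +oo[) (x ^+ 2 * p x)%:E =
    (- F s)%:E + \int[mu]_(x in `[s, +oo[) (s ^+ 2 * p x)%:E)%E.
  rewrite -integral_tail -ge0_integralD//=.
  - by apply: eq_integral => x _; rewrite -EFinD -mulrDl subrK.
  - move=> x; rewrite in_itv/= andbT => sx.
    rewrite lee_fin mulr_ge0// subr_ge0 ler_sqr ?nnegrE ?(ltW s0)//.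
    exact: le_trans (ltW s0) sx.
  - apply/measurable_EFinP/measurable_funTS; apply: measurable_funM => //.
    by apply: measurable_funB => //; exact: exprn_measurable.
  - by move=> x _; rewrite lee_fin.
  - exact/measurable_EFinP/measurable_funTS.
by rewrite tailE addeA headE.
Qed.

Lemma normal_second_moment :
  (\int[normal_prob 0 s]_x (x ^+ 2)%:E = (s ^+ 2)%:E)%E.
Proof.
rewrite ge0_integral_normal_prob; last 2 first.
- by apply/measurable_EFinP; exact: exprn_measurable.
- by move=> x; rewrite lee_fin sqr_ge0.
have even x : p (- x) = p x by rewrite !pE sqrrN.
transitivity (\int[mu]_x (x ^+ 2 * p x)%:E)%E.
  by apply: eq_integral => x _; rewrite EFinM.
rewrite ge0_symfun_integralT; last 3 first.
- by move=> x; rewrite mulr_ge0// sqr_ge0.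
- by move=> x; apply: cvgM; [exact: exprn_continuous|exact: cp].
- by move=> x /=; rewrite even sqrrN.
(* The factor 2 due to evenness moves back onto the integral of [p], turning its half-line mass into
   the total mass 1. *)
rewrite -set_itvcy half_second_moment muleCA set_itvcy.
rewrite -ge0_symfun_integralT//; first by rewrite integral_normal_pdf mule1.
by move=> x /=; rewrite even.
Qed.

End variance.
End NormalMoments.

(** * Independence of the noise from its past *)

Section Independence.
Context {R : realType} {d : measure_display} {T : measurableType d}.
Variable P : probability T R.

(** The lambda half of the pi-lambda argument. Measurability of [E] is carried along because
    complements and unions are computed through additivity of [P]. *)
Lemma dynkin_indep (F : set T) : measurable F ->
  dynkin [set E | measurable E /\ P (E `&` F) = (P E * P F)%E].
Proof.
move=> mF; split => /=.
- by split; [exact: measurableT|rewrite setTI probability_setT mul1e].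
- move=> E [mE EF]; split; first exact: measurableC.
  have finE : P E \is a fin_num by exact: fin_num_measure.
  have finF : P F \is a fin_num by exact: fin_num_measure.
  have finD : P (F `\` E) \is a fin_num.
    by apply: fin_num_measure; exact: measurableD.
  have PF : P F = (P (F `\` E) + P (E `&` F))%E.
    by rewrite (setIC E); exact: measureDI.
  have -> : ~` E `&` F = F `\` E by rewrite setDE setIC.
  rewrite probability_setC//.
  move: PF; rewrite EF -(fineK finE) -(fineK finF) -(fineK finD).
  rewrite -!(EFinM, EFinD, EFinN, EFinB) => -[h]; congr EFin.
  by rewrite mulrBl mul1r {1}h addrK.
- move=> G tG PG; split; first by apply: bigcup_measurable => k _; exact: (PG k).1.
  rewrite setI_bigcupl measure_bigcup//; last 2 first.
  + by move=> i _; apply: measurableI => //; exact: (PG i).1.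
  + by apply: trivIset_setIr.
  rewrite measure_bigcup//; last by move=> i _; exact: (PG i).1.
  have finF : P F \is a fin_num by exact: fin_num_measure.
  rewrite muleC -(fineK finF) -nneseriesZl//.
  by apply: eq_eseriesr => i _; rewrite fineK// [RHS]muleC; exact: (PG i).2.
Qed.

Lemma generated_setT (G : set (set T)) : <<s G >> setT.
Proof. exact: (@measurableT _ (g_sigma_algebraType G)). Qed.

Lemma generated_setI (G : set (set T)) A B :
  <<s G >> A -> <<s G >> B -> <<s G >> (A `&` B).
Proof. exact: (@measurableI _ (g_sigma_algebraType G)). Qed.

Definition past_sigma (n : nat) (w : nat -> T -> 'cV[R]_n) (k : nat) : set (set T) :=
  <<s [set E | exists2 j, (j < k)%N & sigma_rv (w j) E] >>.

Section past.
Variables (n : nat) (w : nat -> T -> 'cV[R]_n).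
Hypothesis mw : forall k i, measurable_fun setT (fun o => w k o i 0).

Lemma sigma_rv_measurable k E : sigma_rv (w k) E -> measurable E.
Proof.
apply: smallest_sub; first exact: sigma_algebra_measurable.
move=> _ [i [A mA ->]]; rewrite -[X in _ X]setTI.
exact: mw.
Qed.

(** Mutual independence treats one event per index, so the product formula is immediate for
    cylinders only; Dynkin's theorem carries it to the whole past. *)
Lemma past_independent (k : nat) (E F : set T) :
  mutually_independent P w -> past_sigma w k E -> sigma_rv (w k) F ->
  P (E `&` F) = (P E * P F)%E.
Proof.
move=> indep pE sF.
have mF := sigma_rv_measurable sF.
pose cyl (Es : nat -> set T) := \bigcap_(j in [set j | j \in iota 0 k]) Es j.
pose G := [set E | exists2 Es : nat -> set T,
  (forall j, sigma_rv (w j) (Es j)) & E = cyl Es].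
have GI : setI_closed G.
  move=> _ _ [Es sEs ->] [Es' sEs' ->]; exists (fun j => Es j `&` Es' j).
    by move=> j; exact: generated_setI (sEs j) (sEs' j).
  by rewrite /cyl bigcapI.
(* [G] is a pi-system generating the past. *)
suff : <<s G >> `<=` [set E | measurable E /\ P (E `&` F) = (P E * P F)%E].
  move=> GP; apply: (GP E _).2.
  move: pE; apply: smallest_sub; first exact: smallest_sigma_algebra.
  move=> H [j jk sH]; apply: sub_sigma_algebra.
  (* A single event of [w j] is the cylinder whose other factors are full. *)
  exists (fun i => if i == j then H else setT).
    by move=> i; case: eqP => [->//|_]; exact: generated_setT.
  apply/seteqP; split => [x Hx i _ /=|x /(_ j) /=]; first by case: eqP.
  by rewrite eqxx; apply; rewrite mem_iota.
rewrite -setI_closed_g_dynkin_g_sigma_algebra//.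
apply: smallest_sub; first exact: dynkin_indep.
move=> _ [Es sEs ->]; split.
  apply: bigcap_measurableType => j _; exact: sigma_rv_measurable (sEs j).
rewrite [X in (X * _)%E]indep//; last exact: iota_uniq.
(* Placing [F] at index [k] turns the intersection with [F] into one cylinder over [k + 1] distinct
   indices. *)
pose Es' j := if (j < k)%N then Es j else F.
have -> : cyl Es `&` F = \bigcap_(j in [set j | j \in iota 0 k.+1]) Es' j.
  apply/seteqP; split => [x [xE xF] j|x xE].
    rewrite /mkset mem_iota add0n /= ltnS leq_eqVlt /Es' => /orP[/eqP ->|jk].
      by rewrite ltnn.
    by rewrite jk; apply: xE; rewrite /mkset mem_iota.
  split=> [j|]; last first.
    by have := xE k; rewrite /Es' ltnn; apply; rewrite /mkset mem_iota add0n ltnSn.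
  rewrite /mkset mem_iota add0n /= => jk; have := xE j; rewrite /Es' jk; apply.
  by rewrite /mkset mem_iota add0n /= ltnS ltnW.
rewrite indep ?iota_uniq//; last first.
  move=> j; rewrite mem_iota add0n /= ltnS leq_eqVlt /Es' => /orP[/eqP ->|->//].
  by rewrite ltnn.
rewrite -addn1 iotaD big_cat/= add0n big_seq1 /Es' ltnn; congr (_ * _)%E.
rewrite big_seq [RHS]big_seq; apply: eq_bigr => j.
by rewrite mem_iota add0n => /= ->.
Qed.

End past.

(** The joint law agrees with the product law on rectangles, hence everywhere; by Fubini the inner
    integral of [x * y] over [y] is [x] times the mean of [Y], which is 0. *)
Lemma integral_mul_independent (X Y : T -> R) :
  measurable_fun setT X -> measurable_fun setT Y ->
  (forall A B : set R, measurable A -> measurable B ->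
    P (X @^-1` A `&` Y @^-1` B) = (P (X @^-1` A) * P (Y @^-1` B))%E) ->
  P.-integrable setT (EFin \o Y) ->
  P.-integrable setT (fun o => (X o * Y o)%:E) ->
  (\int[P]_o (Y o)%:E = 0)%E ->
  (\int[P]_o (X o * Y o)%:E = 0)%E.
Proof.
move=> mX mY indep iY iXY EY.
pose X' : {mfun T >-> R} := mfun_Sub (mem_set mX).
pose Y' : {mfun T >-> R} := mfun_Sub (mem_set mY).
pose PX : probability _ R := distribution P X'.
pose PY : probability _ R := distribution P Y'.
have mXY : measurable_fun setT (fun o => (X o, Y o)) by exact: measurable_fun_pair.
pose Z : {mfun T >-> (R * R)%type} := mfun_Sub (mem_set mXY).
pose PZ : probability _ R := distribution P Z.
have PZE A : measurable A -> (PX \x PY)%E A = PZ A.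
  by apply: product_measure_unique => C D mC mD; exact: indep.
pose g (z : R * R) := (z.1 * z.2)%:E.
have mg : measurable_fun setT g.
  by apply/measurable_EFinP; exact: measurable_funM.
have ig : PZ.-integrable setT g by exact: integrable_pushforward.
have igXY : (PX \x PY)%E.-integrable setT g.
  have /integrableP[_ h] := ig.
  apply/integrableP; split=> //; apply: le_lt_trans h.
  by rewrite (@eq_measure_integral _ _ _ _ PZ)// => A mA _; exact: PZE.
transitivity (\int[PZ]_z g z)%E.
  by rewrite [RHS]integral_pushforward.
rewrite -(@eq_measure_integral _ _ _ _ PZ (PX \x PY)%E); last first.
  by move=> A mA _; exact: PZE.
rewrite -integral12_prod_meas1//= integral0_eq// => x _.
rewrite /fubini_F /g/=.
have iYid : PY.-integrable setT (EFin \o id).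
  by apply: integrable_pushforward => //; exact/measurable_EFinP.
under eq_integral do rewrite EFinM.
rewrite integralZl//.
by rewrite [X in (_ * X)%E]integral_pushforward//= EY mule0.
Qed.

End Independence.

(** * The closed-loop recursion and its measurability *)

Section ClosedLoop.
Context {R : realType} {n m : nat}.
Variables (A : 'M[R]_n) (B : 'M[R]_(n, m)) (K0 K1 : 'M[R]_(m, n)) (Mth : R) (t : nat).

Definition stabilizing_mode (s : 'cV[R]_n * nat) : bool :=
  (0 < s.2)%N || (Mth <= vnorm s.1).

Definition mode_gain (b : bool) : 'M[R]_(m, n) := if b then K0 else K1.

Lemma cl_uE (w : nat -> 'cV[R]_n) k :
  cl_u A B K0 K1 Mth t w k =
  mode_gain (stabilizing_mode (cl_state A B K0 K1 Mth t w k)) *m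
  cl_x A B K0 K1 Mth t w k.
Proof.
rewrite /cl_u /cl_x /switched_ctrl /stabilizing_mode.
by case: (cl_state _ _ _ _ _ _ _ _) => x xi /=; case: ifP => //=; case: ifP.
Qed.

(** The next state before [w k] is added. It is a function of the noises of index below [k], which
    is what makes it independent of [w k]. *)
Definition cl_drift (w : nat -> 'cV[R]_n) k : 'cV[R]_n :=
  (A + B *m mode_gain (stabilizing_mode (cl_state A B K0 K1 Mth t w k))) *m
  cl_x A B K0 K1 Mth t w k.

Lemma cl_driftE (w : nat -> 'cV[R]_n) k :
  cl_drift w k =
  (if stabilizing_mode (cl_state A B K0 K1 Mth t w k) then A + B *m K0
   else A + B *m K1) *m cl_x A B K0 K1 Mth t w k.
Proof. by rewrite /cl_drift /mode_gain; case: ifP. Qed.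

Lemma cl_xS (w : nat -> 'cV[R]_n) k :
  cl_x A B K0 K1 Mth t w k.+1 = cl_drift w k + w k.
Proof. by rewrite /cl_drift mulmxDl -mulmxA -cl_uE. Qed.

Lemma measurable_mulmx d (T : measurableType d) p q (M : 'M[R]_(p, q))
    (X : T -> 'cV[R]_q) i :
  (forall j, measurable_fun setT (fun o => X o j 0)) ->
  measurable_fun setT (fun o => (M *m X o) i 0).
Proof.
move=> mX; under eq_fun do rewrite mxE.
by apply: measurable_sum => j; apply: measurable_funM.
Qed.

Lemma measurable_switched_mulmx d (T : measurableType d) p q
    (M0 M1 : 'M[R]_(p, q)) (b : T -> bool) (X : T -> 'cV[R]_q) i :
  measurable_fun setT b ->
  (forall j, measurable_fun setT (fun o => X o j 0)) ->
  measurable_fun setT (fun o => ((if b o then M0 else M1) *m X o) i 0).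
Proof.
move=> mb mX.
rewrite (_ : (fun o => _) = fun o => if b o then (M0 *m X o) i 0
                                     else (M1 *m X o) i 0).
  by apply: measurable_fun_ifT => //; exact: measurable_mulmx.
by apply/funext => o; case: ifP.
Qed.

Lemma measurable_vnorm d (T : measurableType d) (X : T -> 'cV[R]_n) :
  (forall j, measurable_fun setT (fun o => X o j 0)) ->
  measurable_fun setT (fun o => vnorm (X o)).
Proof.
move=> mX.
have mS : measurable_fun setT (fun o => \sum_i X o i 0 ^+ 2).
  by apply: measurable_sum => j; apply: measurable_funX.
apply: measurableT_comp mS.
by apply: continuous_measurable_fun; exact: sqrt_continuous.
Qed.

Lemma measurable_stabilizing_mode d (T : measurableType d)
    (s : T -> 'cV[R]_n * nat) :
  (forall j, measurable_fun setT (fun o => (s o).1 j 0)) ->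
  measurable_fun setT (fun o => (s o).2) ->
  measurable_fun setT (fun o => stabilizing_mode (s o)).
Proof.
move=> m1 m2; apply: measurable_or.
  exact: (measurableT_comp (f := fun k : nat => (0 < k)%N)).
by apply: measurable_fun_ler => //; exact: measurable_vnorm.
Qed.

Lemma measurable_cl_drift_of_state d (T : measurableType d)
    (w : nat -> T -> 'cV[R]_n) k :
  let s o := cl_state A B K0 K1 Mth t (w^~ o) k in
  (forall j, measurable_fun setT (fun o => (s o).1 j 0)) ->
  measurable_fun setT (fun o => (s o).2) ->
  forall i, measurable_fun setT (fun o => cl_drift (w^~ o) k i 0).
Proof.
move=> s m1 m2 i.
under eq_fun do rewrite cl_driftE.
by apply: measurable_switched_mulmx => //; exact: measurable_stabilizing_mode.
Qed.

(** [T] is arbitrary and only noises of index below [k] are assumed measurable, so that [T] may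
    carry the sigma-algebra of the past: the statement then expresses adaptedness. The counter
    shares the induction because it decides the gain. *)
Lemma measurable_cl_state d (T : measurableType d) (w : nat -> T -> 'cV[R]_n) k :
  (forall j, (j < k)%N -> forall i, measurable_fun setT (fun o => w j o i 0)) ->
  let s o := cl_state A B K0 K1 Mth t (w^~ o) k in
  (forall i, measurable_fun setT (fun o => (s o).1 i 0)) /\
  measurable_fun setT (fun o => (s o).2).
Proof.
elim: k => [|k IH] mw; first by split.
have [|m1 m2] := IH; first by move=> j jk; apply: mw; exact: ltnW.
split=> [i|].
  rewrite (_ : (fun o => _) =
      (fun o => cl_drift (w^~ o) k i 0) \+ (fun o => w k o i 0)); last first.
    by apply/funext => o; rewrite -/(cl_x A B K0 K1 Mth t (w^~ o) k.+1) cl_xS mxE.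
  by apply: measurable_funD; [exact: measurable_cl_drift_of_state|exact: mw].
rewrite (_ : (fun o => _) = fun o =>
    if (0 < (cl_state A B K0 K1 Mth t (w^~ o) k).2)%N
    then (cl_state A B K0 K1 Mth t (w^~ o) k).2.-1
    else if Mth <= vnorm (cl_state A B K0 K1 Mth t (w^~ o) k).1
    then t.-1 else 0%N); last first.
  apply/funext => o /=; rewrite /switched_ctrl.
  by case: ifP => //=; case: ifP.
apply: measurable_fun_ifT.
- exact: (measurableT_comp (f := fun k : nat => (0 < k)%N)).
- exact: (measurableT_comp (f := fun k : nat => k.-1)).
- apply: measurable_fun_ifT => //.
  by apply: measurable_fun_ler => //; exact: measurable_vnorm.
Qed.

Lemma measurable_cl_drift d (T : measurableType d) (w : nat -> T -> 'cV[R]_n) k :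
  (forall j, (j < k)%N -> forall i, measurable_fun setT (fun o => w j o i 0)) ->
  forall i, measurable_fun setT (fun o => cl_drift (w^~ o) k i 0).
Proof.
by move=> /measurable_cl_state[m1 m2] i; exact: measurable_cl_drift_of_state.
Qed.

End ClosedLoop.

(** * Square-integrable variables and their expectations *)

Section SquareIntegrable.
Context {R : realType} {d : measure_display} {T : measurableType d}.
Variable P : probability T R.
Implicit Types f g : T -> R.

Definition L1 f : Prop := P.-integrable setT (EFin \o f).
Definition L2 f : Prop := measurable_fun setT f /\ L1 (fun o => f o ^+ 2).

(** A real-valued integral reads an infinite value as 0, hence the [L1] premises of additivity and
    monotonicity below. *)
Notation E f := (\int[P]_o f o).

Lemma L1_le f g : measurable_fun setT f -> L1 g ->
  (forall o, `|f o| <= g o) -> L1 f.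
Proof.
move=> mf ig fg; apply: le_integrable ig => //; first exact/measurable_EFinP.
by move=> o _ /=; rewrite lee_fin (le_trans (fg o)) ?ler_norm.
Qed.

Lemma L1D f g : L1 f -> L1 g -> L1 (fun o => f o + g o).
Proof. by move=> h1 h2; exact: (integrableD measurableT h1 h2). Qed.

Lemma L1Z (c : R) f : L1 f -> L1 (fun o => c * f o).
Proof. by move=> h; exact: (integrableZl measurableT c h). Qed.

Lemma L1_cst (c : R) : L1 (fun=> c).
Proof. exact: finite_measure_integrable_cst. Qed.

Lemma L1_sum (I : finType) (f : I -> T -> R) :
  (forall i, L1 (f i)) -> L1 (fun o => \sum_i f i o).
Proof.
move=> h; rewrite /L1 (_ : _ \o _ = fun o => (\sum_i (f i o)%:E)%E).
  by apply: integrable_sum => // i _; exact: h.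
by apply/funext => o /=; rewrite sumEFin.
Qed.

Lemma expectD f g : L1 f -> L1 g -> E (fun o => f o + g o) = E f + E g.
Proof. exact: RintegralD. Qed.

Lemma expectZ (c : R) f : L1 f -> E (fun o => c * f o) = c * E f.
Proof. exact: RintegralZl. Qed.

Lemma expect_cst (c : R) : E (fun=> c) = c.
Proof. by rewrite /Rintegral integral_cst//= probability_setT mule1. Qed.

Lemma expect_le f g : L1 f -> L1 g -> (forall o, f o <= g o) -> E f <= E g.
Proof. by move=> h1 h2 fg; apply: le_Rintegral. Qed.

Lemma expect_sum (I : finType) (f : I -> T -> R) :
  (forall i, L1 (f i)) -> E (fun o => \sum_i f i o) = \sum_i E (f i).
Proof.
move=> h; rewrite /Rintegral.
under eq_integral do rewrite -sumEFin.
rewrite integral_sum//= sum_fine// => i _.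
by apply: integrable_fin_num => //; exact: h.
Qed.

Lemma expectE f : L1 f -> (\int[P]_o (f o)%:E = (E f)%:E)%E.
Proof. by move=> h; rewrite /Rintegral fineK//; exact: integrable_fin_num. Qed.

Lemma L2_mul f g : L2 f -> L2 g -> L1 (fun o => f o * g o).
Proof.
move=> [mf if2] [mg ig2].
apply: (L1_le _ (L1D if2 ig2)); first exact: measurable_funM.
by move=> o; rewrite ler_norml; apply/andP; split; nra.
Qed.

Lemma L2_L1 f : L2 f -> L1 f.
Proof.
move=> [mf if2]; apply: (L1_le mf (L1D if2 (L1_cst 1))).
by move=> o; rewrite ler_norml; apply/andP; split; nra.
Qed.

Lemma L2_le f g : measurable_fun setT f -> L1 g ->
  (forall o, f o ^+ 2 <= g o) -> L2 f.
Proof.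
move=> mf ig fg; split=> //; apply: (L1_le _ ig) => [|o].
  exact: measurable_funX.
by rewrite ger0_norm// sqr_ge0.
Qed.

Lemma L2D f g : L2 f -> L2 g -> L2 (fun o => f o + g o).
Proof.
move=> [mf if2] [mg ig2].
apply: (L2_le _ (L1Z 2 (L1D if2 ig2))); first exact: measurable_funD.
by move=> o; have := sqr_ge0 (f o - g o); nra.
Qed.

Section qform.
Variables (n : nat) (M : 'M[R]_n).
Implicit Types X Y : T -> 'cV[R]_n.

Lemma L1_bform X Y : (forall i, L2 (fun o => X o i 0)) ->
  (forall i, L2 (fun o => Y o i 0)) -> L1 (fun o => bform M (X o) (Y o)).
Proof.
move=> hX hY; under eq_fun do rewrite bformE.
by apply: L1_sum => i; apply: L1_sum => j; apply/L1Z/L2_mul.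
Qed.

Lemma expect_bform X Y : (forall i, L2 (fun o => X o i 0)) ->
  (forall i, L2 (fun o => Y o i 0)) ->
  E (fun o => bform M (X o) (Y o)) =
  \sum_i \sum_j M i j * E (fun o => X o i 0 * Y o j 0).
Proof.
move=> hX hY; under eq_Rintegral do rewrite bformE.
rewrite expect_sum => [|i]; last by apply: L1_sum => j; apply/L1Z/L2_mul.
apply: eq_bigr => i _.
rewrite expect_sum => [|j]; last by apply/L1Z/L2_mul.
by apply: eq_bigr => j _; rewrite expectZ//; exact: L2_mul.
Qed.

Lemma L1_qform X : (forall i, L2 (fun o => X o i 0)) ->
  L1 (fun o => qform M (X o)).
Proof. by move=> hX; exact: L1_bform. Qed.

Lemma expect_qform_uncorrelated X Y : M^T = M ->
  (forall i, L2 (fun o => X o i 0)) -> (forall i, L2 (fun o => Y o i 0)) ->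
  (forall i j, E (fun o => X o i 0 * Y o j 0) = 0) ->
  E (fun o => qform M (X o + Y o)) =
  E (fun o => qform M (X o)) + E (fun o => qform M (Y o)).
Proof.
move=> symM hX hY XY0.
have -> : (fun o => qform M (X o + Y o)) = fun o =>
    (qform M (X o) + qform M (Y o)) + 2 * bform M (X o) (Y o).
  apply/funext => o; have := qform_comb 1 1 (X o) (Y o) symM.
  by rewrite !scale1r => ->; ring.
have iX := L1_qform hX; have iY := L1_qform hY.
have iXY := L1_bform hX hY.
rewrite expectD; [|exact: L1D|exact: L1Z].
rewrite expectD// expectZ//.
rewrite expect_bform// big1 ?mulr0 ?addr0// => i _.
by rewrite big1// => j _; rewrite XY0 mulr0.
Qed.

End qform.

Lemma L2_switched_mulmx p q (M0 M1 : 'M[R]_(p, q)) (b : T -> bool)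
    (X : T -> 'cV[R]_q) i :
  measurable_fun setT b -> (forall j, L2 (fun o => X o j 0)) ->
  L2 (fun o => ((if b o then M0 else M1) *m X o) i 0).
Proof.
move=> mb hX.
pose c (M : 'M[R]_(p, q)) : R := \sum_i sqnorm (row i M)^T.
have c0 M : 0 <= c M by apply: sumr_ge0 => k _; exact: sqnorm_ge0.
(* The sum of the two squared Frobenius norms dominates whichever matrix the switch selects. *)
apply: (L2_le (g := fun o => (c M0 + c M1) * sqnorm (X o))).
- by apply: measurable_switched_mulmx => // j; exact: (hX j).1.
- by apply/L1Z/L1_sum => j; exact: (hX j).2.
- move=> o; set M := (if _ then _ else _).
  apply: (@le_trans _ _ (sqnorm (M *m X o))).
    by rewrite /sqnorm (bigD1 i)//= lerDl; apply: sumr_ge0 => k _; exact: sqr_ge0.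
  apply: le_trans (sqnorm_mulmx _ _) _.
  rewrite ler_wpM2r ?sqnorm_ge0// -/(c M) /M.
  by case: ifP => _; rewrite ?lerDl ?lerDr.
Qed.

(** * First and second moments of a Gaussian vector *)

Section Gaussian.
Variables (n : nat) (W : 'M[R]_n) (X : T -> 'cV[R]_n).
Hypotheses (pW : posdef W) (gX : gaussian_vec P W X).

Let Z (v : 'cV[R]_n) o : R := (v^T *m X o) 0 0.

Let mZ v : measurable_fun setT (Z v : T -> measurableTypeR R).
Proof. by apply: measurable_mulmx; exact: gX.1. Qed.

Let Zmfun v : {mfun T >-> measurableTypeR R} :=
  @mfun_Sub _ _ T (measurableTypeR R) (Z v) (mem_set (mZ v)).

Let sd v : R := Num.sqrt (qform W v).

Let lawZ v A : v != 0 -> measurable A ->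
  distribution P (Zmfun v) A = normal_prob 0 (sd v) A.
Proof. by move=> v0 mA; exact: gX.2. Qed.

Let second_moment_lty v : v != 0 ->
  (\int[P]_o (Z v o ^+ 2)%:E = (qform W v)%:E)%E.
Proof.
move=> v0; have qv := pW.2 _ v0.
transitivity (\int[distribution P (Zmfun v)]_x (x ^+ 2)%:E)%E.
  rewrite ge0_integral_pushforward//.
  - by apply/measurable_EFinP; exact: exprn_measurable.
  - by move=> x _; rewrite lee_fin sqr_ge0.
transitivity (\int[normal_prob 0 (sd v)]_x (x ^+ 2)%:E)%E.
  by apply: eq_measure_integral => A mA _; exact: lawZ.
by rewrite normal_second_moment ?sqrtr_gt0// sqr_sqrtr// ltW.
Qed.

Lemma L2_gaussian_comb (v : 'cV[R]_n) : L2 (fun o => (v^T *m X o) 0 0).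
Proof.
(* [gaussian_vec] is silent at [v = 0], where the combination is the constant 0. *)
have [->|v0] := eqVneq v 0.
  under eq_fun do rewrite trmx0 mul0mx mxE.
  by split => //; under eq_fun do rewrite expr0n; exact: L1_cst.
split; first exact: mZ.
apply/integrableP; split; first by apply/measurable_EFinP/measurable_funX/mZ.
under eq_integral do rewrite /= ger0_norm ?sqr_ge0//.
by rewrite second_moment_lty// ltry.
Qed.

Lemma expect_gaussian_comb_sqr (v : 'cV[R]_n) :
  E (fun o => (v^T *m X o) 0 0 ^+ 2) = qform W v.
Proof.
have [->|v0] := eqVneq v 0.
  under eq_Rintegral do rewrite trmx0 mul0mx mxE expr0n.
  by rewrite expect_cst qform0.
by rewrite /Rintegral second_moment_lty.
Qed.

(* The law of [v^T X] depends on [v] through [qform W v] only, so [v^T X] and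
   [- v^T X] have the same mean. *)
Lemma expect_gaussian_comb (v : 'cV[R]_n) : E (fun o => (v^T *m X o) 0 0) = 0.
Proof.
have [->|v0] := eqVneq v 0.
  under eq_Rintegral do rewrite trmx0 mul0mx mxE.
  by rewrite expect_cst.
have law u : u != 0 ->
    (\int[P]_o (Z u o)%:E = \int[normal_prob 0 (sd u)]_x x%:E)%E.
  move=> u0; transitivity (\int[distribution P (Zmfun u)]_x x%:E)%E; last first.
    by apply: eq_measure_integral => A mA _; exact: lawZ.
  rewrite integral_pushforward// preimage_setT.
  exact: (L2_L1 (L2_gaussian_comb u)).
have nv0 : - v != 0 by rewrite oppr_eq0.
have sdN : sd (- v) = sd v by rewrite /sd -scaleN1r qformZ sqrrN expr1n mul1r.
have ZN : E (Z (- v)) = - E (Z v).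
  rewrite -[RHS]mulN1r -expectZ; last exact: L2_L1 (L2_gaussian_comb v).
  by apply: eq_Rintegral => o _; rewrite /Z linearN/= mulNmx mxE mulN1r.
have EZ : E (Z (- v)) = E (Z v).
  by congr fine; apply: etrans (law _ nv0) _; rewrite sdN; exact: esym (law _ v0).
by move: EZ; rewrite ZN -/(Z v) => EZ; lra.
Qed.

Let coordE i o : X o i 0 = Z (delta_mx i 0) o.
Proof. by rewrite /Z trmx_delta -rowE mxE. Qed.

Lemma L2_gaussian i : L2 (fun o => X o i 0).
Proof. by under eq_fun do rewrite coordE; exact: L2_gaussian_comb. Qed.

Lemma expect_gaussian i : E (fun o => X o i 0) = 0.
Proof. by under eq_Rintegral do rewrite coordE; exact: expect_gaussian_comb. Qed.

(** Polarization: the variance of [X_i + X_j] exceeds the sum of the two variances by twice the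
    covariance. *)
Lemma expect_gaussian_mul i j : E (fun o => X o i 0 * X o j 0) = W i j.
Proof.
pose ei : 'cV[R]_n := delta_mx i 0; pose ej : 'cV[R]_n := delta_mx j 0.
have Wij : bform W ei ej = W i j.
  by rewrite /bform trmx_delta -rowE -colE !mxE.
have iij : L1 (fun o => X o i 0 * X o j 0) by apply: L2_mul; exact: L2_gaussian.
have ii : L1 (fun o => Z ei o ^+ 2) by exact: (L2_gaussian_comb ei).2.
have jj : L1 (fun o => Z ej o ^+ 2) by exact: (L2_gaussian_comb ej).2.
have := expect_gaussian_comb_sqr (ei + ej).
have -> : (fun o => (((ei + ej)^T *m X o) 0 0) ^+ 2) = fun o =>
    (Z ei o ^+ 2 + Z ej o ^+ 2) + 2 * (X o i 0 * X o j 0).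
  apply/funext => o; rewrite !coordE linearD/= mulmxDl mxE -!/(Z _ o); ring.
rewrite expectD; [|exact: L1D|exact: L1Z].
rewrite expectD// expectZ// /Z !expect_gaussian_comb_sqr.
have := qform_comb 1 1 ei ej pW.1; rewrite !scale1r => ->.
by rewrite Wij => h; lra.
Qed.

Lemma expect_gaussian_qform (M : 'M[R]_n) : M^T = M ->
  E (fun o => qform M (X o)) = \tr (W *m M).
Proof.
move=> symM; rewrite expect_bform; try exact: L2_gaussian.
rewrite /mxtrace; apply: eq_bigr => i _; rewrite mxE; apply: eq_bigr => j _.
by rewrite expect_gaussian_mul -[in RHS]symM mxE mulrC.
Qed.

End Gaussian.

End SquareIntegrable.

(** Positive definiteness of the difference leaves a margin [c |v|^2], which is at least
    [(c / N) * qform P v] because [qform P v <= N |v|^2]; so the rate can drop by [c / N]. *)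
Lemma posdef_slack (R : realType) n (P A : 'M[R]_n) (r : R) :
  posdef P -> 0 < r -> posdef (r *: P - A^T *m P *m A) ->
  exists r', [/\ 0 < r', r' < r &
    forall v, qform P (A *m v) <= r' * qform P v].
Proof.
move=> pP r0 pD.
have [c c0 cD] := posdef_lower pD.
pose N : R := `|mnorm P| + 1.
have N0 : 0 < N by rewrite ltr_wpDl.
have cN0 : 0 < c / N by rewrite divr_gt0.
(* [r - c / N] might not be positive; the maximum with [r / 2] is, and stays below [r]. *)
exists (Num.max (r - c / N) (r / 2)); split.
- by rewrite lt_max; apply/orP; right; rewrite divr_gt0.
- by rewrite gt_max; apply/andP; split; lra.
- move=> v.
  have qv := posdef_ge0 v pP.
  apply: (@le_trans _ _ ((r - c / N) * qform P v)); last first.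
    by rewrite ler_wpM2r// le_max lexx.
  have := cD v; rewrite qformB_mx qformZ_mx qform_congr => h.
  have : c / N * qform P v <= c * sqnorm v.
    rewrite -mulrA ler_pM2l// ler_pdivrMl//.
    apply: le_trans (qform_le_mnorm _ _) _.
    rewrite ler_wpM2r ?sqnorm_ge0// /N.
    by apply: le_trans (ler_norm _) _; rewrite lerDl.
  by rewrite mulrBl; lra.
Qed.

(** The limsup is an infimum of suprema over neighbourhoods of infinity, and the whole index set is
    one of them. *)
Lemma limn_esup_le_cst (R : realType) (a : (\bar R)^nat) (l : \bar R) :
  (forall k, (a k <= l)%E) -> (limn_esup a <= l)%E.
Proof.
move=> al; rewrite /limn_esup /limf_esup.
apply: (@le_trans _ _ (ereal_sup (a @` setT))).
  by apply: ereal_inf_lbound; exists setT => //; exact: filterT.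
by apply: ge_ereal_sup => _ [k _ <-].
Qed.

(** * The Lyapunov recursion and the cost bound *)

Section SwitchedLoop.
Context {R : realType} {d : measure_display} {Omega : measurableType d}.
Variables (Pr : probability Omega R) (n m : nat).
Variables (A : 'M[R]_n) (B : 'M[R]_(n, m)) (W Q P0 : 'M[R]_n) (Rw : 'M[R]_m).
Variables (w : nat -> Omega -> 'cV[R]_n) (K0 K1 : 'M[R]_(m, n)).
Variables (Mth : R) (t : nat) (rho0 : R).
Hypotheses (n0 : (0 < n)%N) (pW : posdef W).
Hypothesis gw : forall k, gaussian_vec Pr W (w k).
Hypothesis indep : mutually_independent Pr w.
Hypotheses (pQ : posdef Q) (pR : posdef Rw) (pP : posdef P0).
Hypotheses (rho0_gt0 : 0 < rho0) (rho0_lt1 : rho0 < 1).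
Hypothesis contraction :
  posdef (rho0 *: P0 - (A + B *m K0)^T *m P0 *m (A + B *m K0)).

Notation E f := (\int[Pr]_o f o).

Let x k o := cl_x A B K0 K1 Mth t (w^~ o) k.
Let u k o := cl_u A B K0 K1 Mth t (w^~ o) k.
Let y k o := cl_drift A B K0 K1 Mth t (w^~ o) k.
Let mode k o :=
  stabilizing_mode Mth (cl_state A B K0 K1 Mth t (w^~ o) k).
Let calA := Num.max (mnorm (A + B *m K0)) (mnorm (A + B *m K1)).
Let Q01 := Q + K0^T *m Rw *m K0 + K1^T *m Rw *m K1.
Let C := Mth ^+ 2 * calA ^+ 2 * mnorm P0 + \tr (W *m P0).

Let mw k i : measurable_fun setT (fun o => w k o i 0).
Proof. exact: (gw k).1. Qed.

Let mmode k : measurable_fun setT (mode k).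
Proof.
have [m1 m2] := measurable_cl_state A B K0 K1 Mth t (w := w) (k := k)
  (fun j _ => mw j).
exact: measurable_stabilizing_mode.
Qed.

Let yE k o : y k o = (if mode k o then A + B *m K0 else A + B *m K1) *m x k o.
Proof. exact: cl_driftE. Qed.

Let L2_drift k : (forall i, L2 Pr (fun o => x k o i 0)) ->
  forall i, L2 Pr (fun o => y k o i 0).
Proof.
by move=> hx i; under eq_fun do rewrite yE; exact: L2_switched_mulmx.
Qed.

Let L2_w k i : L2 Pr (fun o => w k o i 0).
Proof. exact: L2_gaussian (gw k) _. Qed.

(** Finiteness of second moments has to precede the Lyapunov recursion, whose expectations it makes
    meaningful; no uniformity in [k] is claimed here. *)
Lemma L2_state k i : L2 Pr (fun o => x k o i 0).
Proof.
elim: k i => [|k IH] i.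
  rewrite /x (_ : (fun o => _) = cst 0); last by apply/funext => o; rewrite mxE.
  by split => //; under eq_fun do rewrite expr0n; exact: L1_cst.
rewrite (_ : (fun o => _) = fun o => y k o i 0 + w k o i 0); last first.
  by apply/funext => o; rewrite /x cl_xS mxE.
by apply: L2D => //; exact: L2_drift.
Qed.

Lemma drift_noise_uncorrelated k i j : E (fun o => y k o i 0 * w k o j 0) = 0.
Proof.
have L2y := L2_drift (L2_state k).
rewrite /Rintegral integral_mul_independent//.
- exact: (L2y i).1.
- move=> C1 C2 mC1 mC2.
  (* [measurable_cl_drift] for the sigma-algebra generated by the past noise
     makes [y k] measurable with respect to the past. *)
  pose G := [set F | exists2 l, (l < k)%N & sigma_rv (w l) F].
  have my : measurable_fun setT (fun o : g_sigma_algebraType G => y k o i 0).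
    apply: measurable_cl_drift => l lk a _ V mV; rewrite setTI.
    apply: sub_sigma_algebra; exists l => //.
    by apply: sub_sigma_algebra; exists a; exists V.
  have sE : past_sigma w k ((fun o => y k o i 0) @^-1` C1).
    by rewrite -[X in past_sigma _ _ X]setTI; exact: my.
  have sF : sigma_rv (w k) ((fun o => w k o j 0) @^-1` C2).
    by apply: sub_sigma_algebra; exists j; exists C2.
  exact: past_independent sE sF.
- exact: (L2_L1 (L2_w k j)).
- exact: L2_mul.
- rewrite expectE; first by rewrite (expect_gaussian pW (gw k)).
  exact: (L2_L1 (L2_w k j)).
Qed.

Lemma expect_qform_state k :
  E (fun o => qform P0 (x k.+1 o)) = E (fun o => qform P0 (y k o)) + \tr (W *m P0).
Proof.
rewrite -(expect_gaussian_qform pW (gw k) pP.1).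
rewrite -expect_qform_uncorrelated//; last 3 first.
- exact: pP.1.
- exact/L2_drift/L2_state.
- exact: drift_noise_uncorrelated.
by apply: eq_Rintegral => o _; rewrite /x cl_xS.
Qed.

Let calA_ge0 : 0 <= calA.
Proof. by rewrite le_max mnorm_ge0. Qed.

(** The trace is read as the mean of [qform P0 (w 0)], which is at least [c] times the sum of the
    diagonal entries of [W], all positive. *)
Let C_gt0 : 0 < C.
Proof.
suff tr0 : 0 < \tr (W *m P0).
  by rewrite /C ltr_wpDl// mulr_ge0 ?mnorm_ge0// mulr_ge0 ?sqr_ge0.
have [c c0 cP] := posdef_lower pP.
rewrite -(expect_gaussian_qform pW (gw 0) pP.1).
have i0 : 'I_n := Ordinal n0.
apply: (@lt_le_trans _ _ (E (fun o => c * sqnorm (w 0 o)))); last first.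
  by apply: expect_le => //; [apply/L1Z/L1_sum => j; exact: (L2_w 0 j).2|exact: L1_qform].
rewrite expectZ; last by apply: L1_sum => j; exact: (L2_w 0 j).2.
rewrite pmulr_rgt0// expect_sum => [|j]; last exact: (L2_w 0 j).2.
have EW j : E (fun o => w 0 o j 0 ^+ 2) = qform W (delta_mx j 0).
  rewrite -(expect_gaussian_comb_sqr pW (gw 0)).
  by apply: eq_Rintegral => o _; rewrite trmx_delta -rowE mxE.
have W0 j : 0 < qform W (delta_mx j 0).
  apply: pW.2; apply/eqP => /matrixP/(_ j 0)/eqP.
  by rewrite !mxE !eqxx oner_eq0.
rewrite (bigD1 i0)//= ltr_wpDr//; last by rewrite EW.
by apply: sumr_ge0 => j _; rewrite EW ltW.
Qed.

Let pnorm_gt0 : 0 < pnorm P0 Q01.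
Proof.
have v0 : delta_mx (Ordinal n0) 0 != 0 :> 'cV[R]_n.
  apply/eqP => /matrixP/(_ (Ordinal n0) 0)/eqP.
  by rewrite !mxE !eqxx oner_eq0.
have := qform_le_pnorm Q01 (delta_mx (Ordinal n0) 0) pP.
set v := delta_mx _ _ => h.
have : 0 < pnorm P0 Q01 * qform P0 v.
  apply: lt_le_trans h; rewrite /Q01 !qformD_mx !qform_congr.
  by rewrite !ltr_wpDr ?posdef_ge0//; exact: pQ.2.
by rewrite pmulr_lgt0//; exact: pP.2.
Qed.

(** Only one gain is active at a time; the term of [Q01] for the other one is nonnegative. *)
Let cost_le k o :
  qform Q (x k o) + qform Rw (u k o) <= pnorm P0 Q01 * qform P0 (x k o).
Proof.
apply: le_trans (qform_le_pnorm Q01 _ pP).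
rewrite /Q01 !qformD_mx !qform_congr -addrA lerD2l /u cl_uE -/(x k o) /mode_gain.
by case: ifP => _; rewrite ?lerDl ?lerDr posdef_ge0.
Qed.

Let L1_cost k : L1 Pr (fun o => qform Q (x k o) + qform Rw (u k o)).
Proof.
have iQ := L1_qform Q (L2_state k).
apply: L1D => //; apply: L1_qform => i.
rewrite /u; under eq_fun do rewrite cl_uE.
by apply: L2_switched_mulmx; [exact: mmode|exact: L2_state].
Qed.

Let drift_le r : 0 < r ->
  (forall v, qform P0 ((A + B *m K0) *m v) <= r * qform P0 v) ->
  0 < Mth -> forall k o,
  qform P0 (y k o) <= r * qform P0 (x k o) + Mth ^+ 2 * calA ^+ 2 * mnorm P0.
Proof.
move=> r0 hr M0 k o; rewrite yE; case: ifP => [_|/negbT].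
  apply: le_trans (hr _) _.
  by rewrite lerDl mulr_ge0 ?mnorm_ge0// mulr_ge0 ?sqr_ge0.
rewrite /mode negb_or -ltNge => /andP[_ xM].
apply: ler_wpDl; first by rewrite mulr_ge0 ?posdef_ge0 ?ltW.
apply: le_trans (qform_le_mnorm _ _) _.
rewrite mulrC ler_wpM2r ?mnorm_ge0// -exprMn mulrC -vnorm_sqr.
rewrite ler_sqr ?nnegrE ?vnorm_ge0//; last exact: mulr_ge0 calA_ge0 (ltW M0).
apply: le_trans (vnorm_mulmx _ _) _.
apply: ler_pM; rewrite ?mnorm_ge0 ?vnorm_ge0//; last exact: ltW.
by rewrite le_max lexx orbT.
Qed.

Lemma expect_lyapunov_le r : 0 < r -> r < 1 ->
  (forall v, qform P0 ((A + B *m K0) *m v) <= r * qform P0 v) ->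
  0 < Mth -> forall k, E (fun o => qform P0 (x k o)) <= C / (1 - r).
Proof.
move=> r0 r1 hr M0; elim=> [|k IH].
  under eq_Rintegral do rewrite /x qform0.
  by rewrite expect_cst divr_ge0 ?(ltW C_gt0)// subr_ge0 ltW.
have iV := L1_qform P0 (L2_state k).
rewrite expect_qform_state.
have : E (fun o => qform P0 (y k o)) <=
    r * E (fun o => qform P0 (x k o)) + Mth ^+ 2 * calA ^+ 2 * mnorm P0.
  rewrite -expectZ// -[X in _ + X](expect_cst Pr) -expectD; last 2 first.
  - exact: L1Z.
  - exact: L1_cst.
  apply: expect_le; last exact: drift_le.
  - exact/L1_qform/L2_drift/L2_state.
  - by apply: L1D; [exact: L1Z|exact: L1_cst].
(* [C / (1 - r)] is the fixed point of [v -> r v + C], so the induction reproduces the bound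
   exactly. *)
have -> : C / (1 - r) = r * (C / (1 - r)) + C by field; rewrite subr_eq0 gt_eqF.
move=> h; rewrite {2}/C addrA lerD2r.
apply: le_trans h _; rewrite lerD2r.
by rewrite ler_pM2l.
Qed.

Lemma average_cost_le r : 0 < r -> r < 1 ->
  (forall v, qform P0 ((A + B *m K0) *m v) <= r * qform P0 v) ->
  0 < Mth -> forall T : nat,
  (((T%:R)^-1)%:E *
      'E_Pr[fun o => (\sum_(k < T) (qform Q (x k o) + qform Rw (u k o)))%R] <=
   (C * pnorm P0 Q01 / (1 - r))%:E)%E.
Proof.
move=> r0 r1 hr M0 T.
rewrite unlock expectE; last by apply: L1_sum => k; exact: L1_cost.
rewrite -EFinM lee_fin expect_sum => [|k]; last exact: L1_cost.
have c0 : 0 <= C * pnorm P0 Q01 / (1 - r).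
  by rewrite divr_ge0 ?mulr_ge0 ?(ltW C_gt0) ?(ltW pnorm_gt0)// subr_ge0 ltW.
(* [limn_esup_le_cst] asks for every index, including [T = 0], where the average of the empty sum is
   0. *)
case: T => [|T]; first by rewrite big_ord0 mulr0.
rewrite ler_pdivrMl ?ltr0n//.
apply: (@le_trans _ _ (\sum_(k < T.+1) (C * pnorm P0 Q01 / (1 - r)))); last first.
  by rewrite sumr_const card_ord mulr_natl.
apply: ler_sum => k _.
have iV := L1_qform P0 (L2_state k).
apply: le_trans (expect_le _ _ (cost_le k)) _ => //; first exact: L1Z.
rewrite expectZ// mulrAC [leRHS]mulrC ler_pM2l//.
exact: expect_lyapunov_le.
Qed.

Lemma limsup_average_cost_lt : 0 < Mth ->
  (limn_esup (fun T : nat => ((T%:R)^-1)%:E *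
     'E_Pr[fun o => (\sum_(k < T) (qform Q (x k o) + qform Rw (u k o)))%R]) <
   (C * pnorm P0 Q01 / (1 - rho0))%:E)%E.
Proof.
move=> M0; have [r [r0 rlt hr]] := posdef_slack pP rho0_gt0 contraction.
have r1 : r < 1 := lt_trans rlt rho0_lt1.
apply: le_lt_trans (limn_esup_le_cst (average_cost_le r0 r1 hr M0)) _.
rewrite lte_fin ltr_pM2l ?mulr_gt0//.
by rewrite ltf_pV2 ?posrE ?subr_gt0// ltrD2l ltrN2.
Qed.

End SwitchedLoop.

Unset Implicit Arguments.

Theorem theorem1 (R : realType) (d : measure_display) (Omega : measurableType d)
    (Pr : probability Omega R) (n m : nat)
    (A : 'M[R]_n) (B : 'M[R]_(n, m)) (W Q : 'M[R]_n) (Rw : 'M[R]_m)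
    (w : nat -> Omega -> 'cV[R]_n)
    (K0 K1 : 'M[R]_(m, n)) (Mth : R) (t : nat) (P0 : 'M[R]_n) (rho0 : R) :
  (0 < n)%N ->
  controllable A B ->
  posdef W ->
  (forall k, gaussian_vec Pr W (w k)) ->
  mutually_independent Pr w ->
  posdef Q -> posdef Rw ->
  spectral_radius (A + B *m K0) < 1 ->
  0 < Mth -> (0 < t)%N ->
  posdef P0 -> 0 < rho0 -> rho0 < 1 ->
  posdef (rho0 *: P0 - (A + B *m K0)^T *m P0 *m (A + B *m K0)) ->
  let x k o := cl_x A B K0 K1 Mth t (fun j => w j o) k in
  let u k o := cl_u A B K0 K1 Mth t (fun j => w j o) k in
  let J := limn_esup (fun T : nat =>
      ((T%:R)^-1)%:E *
      'E_Pr[fun o => (\sum_(k < T) (qform Q (x k o) + qform Rw (u k o)))%R])%E in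
  let calA := Num.max (mnorm (A + B *m K0)) (mnorm (A + B *m K1)) in
  let Q01 := Q + K0^T *m Rw *m K0 + K1^T *m Rw *m K1 in
  (J < ((Mth ^+ 2 * calA ^+ 2 * mnorm P0 + \tr (W *m P0)) * pnorm P0 Q01
        / (1 - rho0))%:E)%E.
Proof.
move=> n0 _ pW gw indep pQ pR _ M0 _ pP r0 r1 contraction.
exact: limsup_average_cost_lt.
Qed.
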